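(* Let $V$ and $W$ be finite-dimensional diffeological vector spaces with maximal isotropic subspaces $V_1$ and $W_1$ respectively, and let $f:V\to W$ be a smooth linear map. Then $f$ descends to a well-defined linear (and necessarily smooth) map $f_/:V/V_1\to W/W_1$ between their characteristic quotients.
   Context: A diffeological space is a set $X$ with a collection of maps (plots) $U\to X$, for $U$ open in $\mathbb{R}^n$, $n\in\mathbb{N}$, such that: constant maps are plots; the composition of a plot with an ordinary smooth map between open sets of Euclidean spaces is a plot; a map that is locally a plot is a plot. A map $f:X\to Y$ is smooth if $f\circ p$ is a plot of $Y$ for every plot $p$ of $X$. A diffeological vector space is a real vector space with a diffeology for which addition and scalar multiplication are smooth (products carry the product diffeology, $\mathbb{R}$ its standard diffeology). The diffeological dual $V^*$ is the vector space of all smooth linear maps $V\to\mathbb{R}$. A diffeological pseudo-metric on $V$ of finite dimension $n$ is a smooth symmetric semi-positive definite bilinear form $g:V\times V\to\mathbb{R}$ whose maximal isotropic subspace ($\{v\in V: g(v,w)=0\ \forall w\in V\}$) has dimension exactly $n-\dim(V^* )$. Pseudo-metrics always exist, and all pseudo-metrics on $V$ have the same maximal isotropic subspace $V_1$, called the maximal isotropic subspace of $V$; it equals the intersection of the kernels of all smooth linear functions $V\to\mathbb{R}$. The characteristic quotient of $V$ is the quotient vector space $V/V_1$ with the quotient diffeology (plots are the maps that locally lift to plots of $V$). *)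

(* Defs.v *)
From HB Require Import structures.
From mathcomp Require Import all_boot all_order all_algebra.
From mathcomp Require Import all_classical all_reals all_analysis.
Set Implicit Arguments.
Unset Strict Implicit.
Unset Printing Implicit Defensive.
Import Order.TTheory GRing.Theory Num.Theory.
Import numFieldNormedType.Exports.
Local Open Scope classical_set_scope.
Local Open Scope ring_scope.
Local Open Scope quotient_scope.

(** A map defined on an open set [U] of a Euclidean space is represented by a
    total function, of which only the values on [U] matter. *)

Section Smooth.
Variable R : realType.

(** [f] is of class C^(k+1) on [U] when it is (Frechet) differentiable there
    and all its directional derivatives are of class C^k. *)
Fixpoint Ck (k n : nat) (E : normedModType R) (U : set 'rV[R]_n)
    (f : 'rV[R]_n -> E) : Prop :=
  match k with
  | 0 => forall x, U x -> {for x, continuous f}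
  | k'.+1 => (forall x, U x -> differentiable f x) /\
             (forall v, Ck k' U ('D_v f))
  end.

Definition smooth_on n (E : normedModType R) (U : set 'rV[R]_n)
    (f : 'rV[R]_n -> E) : Prop :=
  forall k, Ck k U f.


Lemma Ck_S k n (E : normedModType R) (U : set 'rV[R]_n) (f : 'rV[R]_n -> E) :
  Ck k.+1 U f -> Ck k U f.
Proof.
elim: k f => [|k IH] f.
  by move=> [df _] x Ux; exact: differentiable_continuous (df x Ux).
by move=> [df Hf]; split=> // v; apply: IH; exact: Hf.
Qed.

Lemma near_eq_open n (T : Type) (U : set 'rV[R]_n) (f g : 'rV[R]_n -> T) :
  open U -> (forall x, U x -> f x = g x) ->
  forall x, U x -> \forall y \near x, f y = g y.
Proof.
move=> oU fg x Ux; apply: filterS fg _.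
exact: open_nbhs_nbhs.
Qed.

Lemma near_eq_differentiable n (E : normedModType R) (f g : 'rV[R]_n -> E) x :
  (\forall y \near x, f y = g y) -> differentiable f x -> differentiable g x.
Proof.
move=> fg df.
pose z : {linear 'rV[R]_n -> E} := \0.
have cz : continuous z by move=> y; exact: cst_continuous.
have e0 : (g \- f) \o shift x = cst ((g \- f) x) + z +o_ (0 : 'rV[R]_n) id.
  apply/eqaddoP => _/posnumP[e].
  have -> : (g \- f) x = 0 by rewrite /= (nbhs_singleton fg) subrr.
  near=> y.
  rewrite [X in `|X|](_ : _ = 0) ?normr0 ?mulr_ge0//.
  have -> : ((g \- f) \o shift x - (cst 0 + z)) y = g (y + x) - f (y + x) - (0 + 0) by [].
  rewrite addr0 subr0; apply/eqP; rewrite subr_eq0 eq_sym; apply/eqP.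
  near: y.
  have := fg; rewrite (near_shift 0) subr0.
  by apply: filterS.
have de : differentiable (g \- f) x.
  by apply/diff_locallyP; rewrite (diff_unique cz e0).
have -> : g = (g \- f) + f by apply/funext => y; rewrite /= subrK.
exact: differentiableD.
Unshelve. all: by end_near. Qed.

Lemma Ck_ext k n (E : normedModType R) (U : set 'rV[R]_n)
    (f g : 'rV[R]_n -> E) :
  open U -> (forall x, U x -> f x = g x) -> Ck k U f -> Ck k U g.
Proof.
move=> oU; elim: k f g => [|k IH] f g fg /=.
  move=> cf x Ux; have fgx := near_eq_open oU fg Ux.
  have := cf x Ux; rewrite /prop_for /continuous_at (nbhs_singleton fgx).
  apply: cvg_trans; apply: (@near_eq_cvg _ _ (nbhs x)).
  by apply: filterS fgx => y ->.
move=> [df Hf]; split=> [x Ux|v].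
  exact: near_eq_differentiable (near_eq_open oU fg Ux) (df x Ux).
apply: IH (Hf v) => x Ux; exact: near_eq_derive (near_eq_open oU fg Ux).
Qed.

Lemma Ck_local k n (E : normedModType R) (U : set 'rV[R]_n)
    (f : 'rV[R]_n -> E) :
  (forall x, U x -> exists A, [/\ A x, A `<=` U & Ck k A f]) -> Ck k U f.
Proof.
elim: k f => [|k IH] f H /=.
  by move=> x Ux; have [A [Ax _ cf]] := H x Ux; exact: cf.
split=> [x Ux|v]; first by have [A [Ax _ [df _]]] := H x Ux; exact: df.
by apply: IH => x Ux; have [A [Ax AU [_ HA]]] := H x Ux; exists A; split=> //; exact: HA.
Qed.

Lemma Ck_sub k n (E : normedModType R) (U A : set 'rV[R]_n)
    (f : 'rV[R]_n -> E) : A `<=` U -> Ck k U f -> Ck k A f.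
Proof.
move=> AU; elim: k f => [|k IH] f /=; first by move=> cf x /AU; exact: cf.
by move=> [df Hf]; split=> [x /AU|v]; [exact: df | exact: IH].
Qed.

Lemma Ck_cst k n (E : normedModType R) (U : set 'rV[R]_n) (c : E) :
  Ck k U (fun=> c).
Proof.
elim: k c => [|k IH] c /=; first by move=> x _; exact: cst_continuous.
split=> [x _|v]; first exact: differentiable_cst.
suff -> : 'D_v (fun _ : 'rV[R]_n => c) = (fun=> 0) by exact: IH.
by apply/funext => x; exact: derive_cst.
Qed.

Lemma CkD k n (U : set 'rV[R]_n) (f g : 'rV[R]_n -> R) :
  open U -> Ck k U f -> Ck k U g -> Ck k U (fun x => f x + g x).
Proof.
move=> oU; elim: k f g => [|k IH] f g /=.
  by move=> cf cg x Ux; apply: continuousD; [exact: cf | exact: cg].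
move=> [df Hf] [dg Hg]; split=> [x Ux|v].
  by apply: differentiableD; [exact: df | exact: dg].
apply: Ck_ext (IH _ _ (Hf v) (Hg v)) => // x Ux.
by rewrite -deriveD //; apply: diff_derivable; [exact: df | exact: dg].
Qed.

Lemma CkM k n (U : set 'rV[R]_n) (f g : 'rV[R]_n -> R) :
  open U -> Ck k U f -> Ck k U g -> Ck k U (fun x => f x * g x).
Proof.
move=> oU; elim: k f g => [|k IH] f g.
  by move=> cf cg x Ux; apply: continuousM; [exact: cf | exact: cg].
move=> Cf Cg; have [df Hf] := Cf; have [dg Hg] := Cg; split=> [x Ux|v].
  by apply: differentiableM; [exact: df | exact: dg].
apply: Ck_ext (CkD oU (IH _ _ (Ck_S Cf) (Hg v)) (IH _ _ (Ck_S Cg) (Hf v))) => //.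
move=> x Ux; rewrite (@deriveM _ _ f g) //.
  by apply: diff_derivable; exact: df.
by apply: diff_derivable; exact: dg.
Qed.

Lemma Ck_coord k m n (U : set 'rV[R]_m) (F : 'rV[R]_m -> 'rV[R]_n) i :
  open U -> Ck k U F -> Ck k U (fun x => F x 0 i).
Proof.
move=> oU; elim: k F => [|k IH] F /=.
  move=> cF x Ux.
  apply: (@continuous_comp _ _ _ F (fun M : 'rV[R]_n => M 0 i)); first exact: cF.
  exact: coord_continuous.
move=> [dF HF]; split=> [x Ux|v].
  apply: (@differentiable_comp _ _ _ _ F (fun M : 'rV[R]_n => M 0 i)).
    exact: dF.
  exact: differentiable_coord.
apply: Ck_ext (IH _ (HF v)) => // x Ux.
by rewrite derive_mx ?mxE//; apply: diff_derivable; exact: dF.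
Qed.

Lemma Ck_comp k m n (U : set 'rV[R]_n) (A : set 'rV[R]_m)
    (g : 'rV[R]_n -> R) (F : 'rV[R]_m -> 'rV[R]_n) :
  open A -> (forall x, A x -> U (F x)) -> Ck k U g -> Ck k A F ->
  Ck k A (g \o F).
Proof.
move=> oA FU; elim: k g F FU => [|k IH] g F FU.
  move=> cg cF x Ax; apply: continuous_comp; first exact: cF.
  by apply: cg; exact: FU.
move=> Cg CF; have [dg Hg] := Cg; have [dF HF] := CF; split=> [x Ax|v].
  by apply: differentiable_comp; [exact: dF | apply: dg; exact: FU].
apply: (@Ck_ext _ _ _ _
  (fun x => \sum_(i < n) ('D_v F x) 0 i * ('D_(delta_mx 0 i) g \o F) x)) => //.
  move=> x Ax; have dFx := dF x Ax; have dgx := dg _ (FU x Ax).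
  have -> : 'D_v (g \o F) x = 'd g (F x) ('D_v F x).
    rewrite (deriveE v (differentiable_comp dFx dgx)) (deriveE v dFx).
    by rewrite (diff_comp dFx dgx).
  move: ('D_v F x) => w.
  rewrite [X in _ = _ X]row_sum_delta linear_sum.
  by apply: eq_bigr => i _; rewrite linearZ /= (deriveE _ dgx).
have H i : Ck k A (fun x => ('D_v F x) 0 i * ('D_(delta_mx 0 i) g \o F) x).
  apply: CkM => //; first exact: Ck_coord (HF v).
  exact: IH FU (Hg _) (Ck_S CF).
elim: (index_enum _) => [|i s IHs].
  rewrite (_ : (fun=> _) = fun=> 0); first exact: Ck_cst.
  by apply/funext => x; rewrite big_nil.
rewrite (_ : (fun=> _) = fun x => ('D_v F x) 0 i * ('D_(delta_mx 0 i) g \o F) x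
  + \sum_(j <- s) ('D_v F x) 0 j * ('D_(delta_mx 0 j) g \o F) x).
  by apply: CkD.
by apply/funext => x; rewrite big_cons.
Qed.

End Smooth.

(** A plot [U -> X] is represented by a total function together
    with its open domain [U]; [plot_ext] says that only its values on [U]
    matter. *)

Record diffeology (R : realType) (X : Type) := Diffeology {
  plot : forall n, set 'rV[R]_n -> ('rV[R]_n -> X) -> Prop;
  plot_open : forall n (U : set 'rV[R]_n) (p : 'rV[R]_n -> X),
    plot U p -> open U;
  plot_ext : forall n (U : set 'rV[R]_n) (p q : 'rV[R]_n -> X),
    (forall x, U x -> p x = q x) -> plot U p -> plot U q;
  plot_cst : forall n (U : set 'rV[R]_n) (x : X),
    open U -> plot U (fun=> x);
  plot_comp : forall m n (A : set 'rV[R]_m) (U : set 'rV[R]_n)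
      (F : 'rV[R]_m -> 'rV[R]_n) (p : 'rV[R]_n -> X),
    open A -> smooth_on A F -> (forall x, A x -> U (F x)) ->
    plot U p -> plot A (p \o F);
  plot_local : forall n (U : set 'rV[R]_n) (p : 'rV[R]_n -> X),
    open U ->
    (forall x, U x -> exists A : set 'rV[R]_n,
      [/\ open A, A x, A `<=` U & plot A p]) ->
    plot U p }.

Definition smooth (R : realType) (X Y : Type) (DX : diffeology R X)
    (DY : diffeology R Y) (f : X -> Y) : Prop :=
  forall n (U : set 'rV[R]_n) (p : 'rV[R]_n -> X),
    plot DX U p -> plot DY U (f \o p).

Section StandardDiffeology.
Variable R : realType.

Definition real_plot n (U : set 'rV[R]_n) (p : 'rV[R]_n -> R^o) : Prop :=
  open U /\ smooth_on U p.

Program Definition real_diffeology : diffeology R R^o :=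
  @Diffeology R R^o real_plot _ _ _ _ _.
Next Obligation. by move=> n U p []. Qed.
Next Obligation.
by move=> n U p q pq [oU sp]; split=> // k; exact: Ck_ext (sp k).
Qed.
Next Obligation. by move=> n U x oU; split=> // k; exact: Ck_cst. Qed.
Next Obligation.
move=> m n A U F p oA sF FU [_ sp]; split=> // k.
exact: Ck_comp oA FU (sp k) (sF k).
Qed.
Next Obligation.
move=> n U p oU H; split=> // k; apply: Ck_local => x Ux.
by have [A [oA Ax AU [_ sp]]] := H x Ux; exists A; split.
Qed.

End StandardDiffeology.

Section ProductDiffeology.
Variables (R : realType) (X Y : Type).
Variables (DX : diffeology R X) (DY : diffeology R Y).

Definition prod_plot n (U : set 'rV[R]_n) (p : 'rV[R]_n -> X * Y) : Prop :=
  plot DX U (fst \o p) /\ plot DY U (snd \o p).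

Program Definition prod_diffeology : diffeology R (X * Y) :=
  @Diffeology R (X * Y) prod_plot _ _ _ _ _.
Next Obligation. by move=> n U p [/plot_open]. Qed.
Next Obligation.
move=> n U p q pq [p1 p2]; split.
  by apply: plot_ext p1 => x Ux; rewrite /= pq.
by apply: plot_ext p2 => x Ux; rewrite /= pq.
Qed.
Next Obligation. by move=> n U x oU; split; exact: plot_cst. Qed.
Next Obligation.
move=> m n A U F p oA sF FU [p1 p2]; split.
  exact: (plot_comp oA sF FU p1).
exact: (plot_comp oA sF FU p2).
Qed.
Next Obligation.
move=> n U p oU H; split; apply: plot_local => // x Ux;
  by have [A [oA Ax AU [p1 p2]]] := H x Ux; exists A; split.
Qed.

End ProductDiffeology.

Record diffeological_vector_space (R : realType) (V : lmodType R)
    (D : diffeology R V) : Prop := DiffeologicalVectorSpace {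
  smooth_add : smooth (prod_diffeology D D) D (fun x => x.1 + x.2);
  smooth_scale :
    smooth (prod_diffeology (real_diffeology R) D) D (fun x => x.1 *: x.2) }.

(** [vspace_of P] is the subspace whose elements are the [v] such that [P v];
    it is meaningful when [P] is closed under linear combinations, as is the
    case in each use below. *)

Section VspaceOf.
Variables (K : fieldType) (V : vectType K).

Definition vspace_of (P : set V) : {vspace V} :=
  xget 0%VS [set U : {vspace V} | forall v, (v \in U) <-> P v].

Lemma vspace_ofP (P : set V) :
  P 0 -> (forall a u v, P u -> P v -> P (a *: u + v)) ->
  forall v, (v \in vspace_of P) <-> P v.
Proof.
move=> P0 PL.
pose Q d := `[< exists U : {vspace V},
  \dim U = d /\ forall v, v \in U -> P v >].
have exQ : exists d, Q d.
  exists 0%N; apply/asboolP; exists 0%VS; split; first exact: dimv0.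
  by move=> v; rewrite memv0 => /eqP ->.
have bQ d : Q d -> (d <= \dim {:V})%N.
  by move=> /asboolP[U [<- _]]; exact/dimvS/subvf.
have [d /asboolP[U [dU UP]] maxd] := ex_maxnP exQ bQ.
suff HU : [set U : {vspace V} | forall v, (v \in U) <-> P v] U.
  exact: (@xgetI _ 0%VS _ U HU).
move=> v; split; first exact: UP.
move=> Pv; have : Q (\dim (U + <[v]>)).
  apply/asboolP; exists (U + <[v]>)%VS; split=> // w.
  case/memv_addP => u uU [_ /vlineP[a ->] ->].
  by rewrite addrC; apply: PL => //; exact: UP.
move=> /maxd; rewrite -dU => le_dim.
have /eqP UE : (U == U + <[v]>)%VS.
  by rewrite -(geq_leqif (dimv_leqif_eq (addvSl U <[v]>))).
by rewrite UE; apply/(subvP (addvSr U <[v]>))/memv_line.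
Qed.

End VspaceOf.

Section PseudoMetric.
Variables (R : realType) (V : vectType R) (D : diffeology R V).

Definition ddual : {vspace 'Hom(V, R^o)} :=
  vspace_of [set phi : 'Hom(V, R^o) | smooth D (real_diffeology R) phi].

Lemma ddualP (phi : 'Hom(V, R^o)) :
  (phi \in ddual) <-> smooth D (real_diffeology R) phi.
Proof.
apply: (vspace_ofP (P := [set phi : 'Hom(V, R^o) | smooth D _ phi])) => /=.
  move=> n U p pp; apply: plot_ext (plot_cst _ 0 (plot_open pp)) => x _.
  by rewrite /= lfunE.
move=> a u v su sv n U p pp.
have [oU Cu] := su n U p pp; have [_ Cv] := sv n U p pp.
split=> // k; apply: Ck_ext (CkD oU (CkM oU (Ck_cst k U a) (Cu k)) (Cv k)) => //.
by move=> x _; rewrite /= !lfunE /= lfunE.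
Qed.

Definition isotropic (g : {bilinear V -> V -> R^o}) : {vspace V} :=
  vspace_of [set v | forall w, g v w = 0].

Lemma isotropicP (g : {bilinear V -> V -> R^o}) (v : V) :
  (v \in isotropic g) <-> (forall w, g v w = 0).
Proof.
apply: (vspace_ofP (P := [set v | forall w, g v w = 0])) => /=.
  by move=> w; rewrite linear0l.
by move=> a x y gx gy w; rewrite linearPl /= gx gy scaler0 addr0.
Qed.

(** The subtraction in [pseudo_metric_dim] is not truncated, as [ddual] is a
    subspace of the linear dual of [V]. *)
Record pseudo_metric (g : {bilinear V -> V -> R^o}) : Prop := PseudoMetric {
  pseudo_metric_smooth :
    smooth (prod_diffeology D D) (real_diffeology R) (fun x => g x.1 x.2);
  pseudo_metric_sym : forall v w, g v w = g w v;
  pseudo_metric_ge0 : forall v, 0 <= g v v :> R;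
  pseudo_metric_dim : \dim (isotropic g) = (\dim {:V} - \dim ddual)%N }.

Definition maximal_isotropic (V1 : {vspace V}) : Prop :=
  exists g : {bilinear V -> V -> R^o}, pseudo_metric g /\ V1 = isotropic g.

End PseudoMetric.

Section QuotientSpace.
Variables (K : fieldType) (V : vectType K) (U : {vspace V}).

Definition vquot := Quotient.quot (pred_of_vspace U).

HB.instance Definition _ := GRing.Zmodule.on vquot.
HB.instance Definition _ := ZmodQuotient.on vquot.

Lemma vquot_eqP (u v : V) :
  (\pi_vquot u == \pi_vquot v) = (u - v \in U).
Proof. by rewrite -Quotient.idealrBE. Qed.

Definition vquot_scale (a : K) (x : vquot) : vquot := \pi_vquot (a *: repr x).

Lemma pi_vquot_scale a v : vquot_scale a (\pi_vquot v) = \pi_vquot (a *: v).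
Proof.
apply/eqP; rewrite vquot_eqP -scalerBr memvZ// -vquot_eqP.
by rewrite reprK.
Qed.

Fact vquot_scaleA a b (x : vquot) :
  vquot_scale a (vquot_scale b x) = vquot_scale (a * b) x.
Proof. by elim/quotW: x => v; rewrite (pi_vquot_scale b v) !pi_vquot_scale scalerA. Qed.

Fact vquot_scale1 : left_id 1 vquot_scale.
Proof. by move=> x; elim/quotW: x => v; rewrite pi_vquot_scale scale1r. Qed.

Fact vquot_scaleDr : right_distributive vquot_scale +%R.
Proof.
move=> a x y; elim/quotW: x => u; elim/quotW: y => v.
by rewrite -raddfD (pi_vquot_scale a (u + v)) (pi_vquot_scale a u)
  (pi_vquot_scale a v) -raddfD scalerDr.
Qed.

Fact vquot_scaleDl x : {morph vquot_scale^~ x : a b / a + b}.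
Proof.
move=> a b; elim/quotW: x => v.
by rewrite (pi_vquot_scale (a + b) v) (pi_vquot_scale a v)
  (pi_vquot_scale b v) scalerDl raddfD.
Qed.

HB.instance Definition _ := GRing.Zmodule_isLmodule.Build K vquot
  vquot_scaleA vquot_scale1 vquot_scaleDr vquot_scaleDl.

End QuotientSpace.

Section QuotientDiffeology.
Variables (R : realType) (V : vectType R) (D : diffeology R V).
Variable V1 : {vspace V}.

Definition quot_plot n (U : set 'rV[R]_n) (p : 'rV[R]_n -> vquot V1) : Prop :=
  open U /\ forall x, U x -> exists (A : set 'rV[R]_n) (q : 'rV[R]_n -> V),
    [/\ A x, A `<=` U, plot D A q & forall y, A y -> p y = \pi_(vquot V1) (q y)].

Lemma smooth_on_preimage m n (A : set 'rV[R]_m) (U : set 'rV[R]_n)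
    (F : 'rV[R]_m -> 'rV[R]_n) :
  open A -> open U -> smooth_on A F -> open (A `&` F @^-1` U).
Proof.
move=> oA oU sF; rewrite openE => x [Ax UFx]; rewrite /interior /=.
apply: filterI; first exact: open_nbhs_nbhs.
by apply: (sF 0%N x Ax); exact: open_nbhs_nbhs.
Qed.

Program Definition quot_diffeology : diffeology R (vquot V1) :=
  @Diffeology R (vquot V1) quot_plot _ _ _ _ _.
Next Obligation. by move=> n U p []. Qed.
Next Obligation.
move=> n U p q pq [oU H]; split=> // x Ux.
have [A [r [Ax AU rA pr]]] := H x Ux; exists A, r; split=> // y Ay.
by rewrite -pq ?pr//; exact: AU.
Qed.
Next Obligation.
move=> n U x oU; split=> // y Uy; exists U, (fun=> repr x); split=> //.
  exact: plot_cst.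
by move=> z _; rewrite reprK.
Qed.
Next Obligation.
move=> m n A U F p oA sF FU [oU H]; split=> // x Ax.
have [B [q [BFx BU qB pq]]] := H _ (FU x Ax).
have oB := plot_open qB; have oAB := smooth_on_preimage oA oB sF.
exists (A `&` F @^-1` B), (q \o F); split=> //.
- apply: (@plot_comp _ _ D _ _ _ B F q oAB _ _ qB); last by move=> y [].
  by move=> k; apply: Ck_sub (sF k) => y [].
- by move=> y [_ By]; exact: pq.
Qed.
Next Obligation.
move=> n U p oU H; split=> // x Ux.
have [A [oA Ax AU [_ HA]]] := H x Ux.
have [B [q [Bx BA qB pq]]] := HA x Ax; exists B, q; split=> //.
exact: subset_trans BA AU.
Qed.

End QuotientDiffeology.

(* Main.v *)
(** Sending [v] to [g v] for a pseudo-metric [g] on [V] gives a linear map from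
    [V] to the smooth dual with kernel [V1]; by the dimension condition it is
    onto. Hence every smooth linear form is some [g v] and kills [V1], so [V1]
    is the common kernel of the smooth linear forms. Smooth linear forms on [W]
    pull back along [f], so [f] maps [V1] into [W1]. *)

Require Import Defs.
From HB Require Import structures.
From mathcomp Require Import all_boot all_order all_algebra.
From mathcomp Require Import all_classical all_reals all_analysis.
Set Implicit Arguments.
Unset Strict Implicit.
Unset Printing Implicit Defensive.
Import Order.TTheory GRing.Theory Num.Theory.
Import numFieldNormedType.Exports.
Local Open Scope classical_set_scope.
Local Open Scope ring_scope.
Local Open Scope quotient_scope.

Section MaximalIsotropic.
Variables (R : realType) (V : vectType R) (D : diffeology R V).

(** Constant maps are plots, so pairing a plot of [V] with the constant [v] gives a plot of the
    product. *)
Lemma smooth_bilinear_section (g : {bilinear V -> V -> R^o}) (v : V) :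
  smooth (prod_diffeology D D) (real_diffeology R) (fun x => g x.1 x.2) ->
  smooth D (real_diffeology R) (g v).
Proof.
move=> sg n U p pp; apply: (sg n U (fun x => (v, p x))); split => //=.
exact/plot_cst/plot_open/pp.
Qed.

(** [R^o] has dimension 1, so ['Hom(V, R^o)] has the dimension of [V]. This bound lets the
    natural-number subtraction in [pseudo_metric_dim] be undone. *)
Lemma dim_ddual_le : (\dim (ddual D) <= \dim {:V})%N.
Proof.
apply: leq_trans (dimvS (subvf _)) _.
by rewrite !dimvf /dim /= muln1.
Qed.

Lemma pseudo_metric_riesz (g : {bilinear V -> V -> R^o})
    (phi : 'Hom(V, R^o)) :
  pseudo_metric D g -> smooth D (real_diffeology R) phi ->
  exists v, phi =1 g v.
Proof.
move=> [sg _ _ dimg] sphi.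
pose G v : 'Hom(V, R^o) := linfun (g v).
have GE v w : G v w = g v w by rewrite lfunE.
have linG : linear G.
  by move=> a u v; apply/lfunP => w; rewrite add_lfunE scale_lfunE !GE linearPl.
pose linGM := GRing.isLinear.Build R V 'Hom(V, R^o) *:%R G linG.
pose Glin : {linear V -> 'Hom(V, R^o)} := HB.pack G linGM.
pose h : 'Hom(V, 'Hom(V, R^o)) := linfun Glin.
have hE v w : h v w = g v w by rewrite lfunE /= GE.
have kerh : lker h = isotropic g.
  apply/vspaceP => v; rewrite memv_ker; apply/eqP/idP.
    by move=> hv; apply/isotropicP => w; rewrite -hE hv lfunE.
  by move=> /isotropicP gv; apply/lfunP => w; rewrite hE gv lfunE.
have sub_img : (limg h <= ddual D)%VS.
  apply/subvP => _ /memv_imgP[v _ ->]; apply/ddualP => n U p pp.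
  apply: plot_ext (smooth_bilinear_section v sg pp) => x _.
  by rewrite /= hE.
(* Rank-nullity: the kernel takes up [\dim {:V} - \dim (ddual D)], which leaves [\dim (ddual D)] for
   the image. *)
have dim_img : \dim (limg h) = \dim (ddual D).
  have := limg_ker_dim h fullv; rewrite capfv kerh dimg => dimE.
  by apply/eqP; rewrite -(eqn_add2l (\dim {:V} - \dim (ddual D))) dimE subnK
    ?dim_ddual_le.
have img : limg h = ddual D by apply/eqP; rewrite eqEdim sub_img dim_img /=.
have : phi \in limg h by rewrite img; apply/ddualP.
by case/memv_imgP => v _ ->; exists v => w; rewrite hE.
Qed.

(** If [phi] is [g u], symmetry gives [phi v = g v u = 0]; conversely, each [g w] is itself a smooth
    form. As the criterion does not mention [g], [V1] is the same for all pseudo-metrics. *)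
Lemma maximal_isotropicP (V1 : {vspace V}) (v : V) :
  maximal_isotropic D V1 ->
  v \in V1 <-> forall phi : 'Hom(V, R^o),
    smooth D (real_diffeology R) phi -> phi v = 0.
Proof.
move=> [g [pmg ->]]; have [sg symg _ _] := pmg; split.
  move=> /isotropicP gv phi /(pseudo_metric_riesz pmg)[u ->].
  by rewrite symg gv.
move=> kv; apply/isotropicP => w; rewrite symg.
rewrite -[LHS](lfunE (g w)); apply: kv => n U p pp.
by apply: plot_ext (smooth_bilinear_section w sg pp) => x _; rewrite /= lfunE.
Qed.

End MaximalIsotropic.

Lemma smooth_linear_maximal_isotropic (R : realType) (V W : vectType R)
    (DV : diffeology R V) (DW : diffeology R W)
    (V1 : {vspace V}) (W1 : {vspace W}) (f : {linear V -> W}) (v : V) :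
  maximal_isotropic DV V1 -> maximal_isotropic DW W1 -> smooth DV DW f ->
  v \in V1 -> f v \in W1.
Proof.
move=> mV mW sf vV1; apply/(maximal_isotropicP _ mW) => phi sphi.
have := (maximal_isotropicP v mV).1 vV1 (phi \o linfun f)%VF.
rewrite comp_lfunE lfunE; apply => n U p pp.
by apply: plot_ext (sphi n U _ (sf n U p pp)) => x _; rewrite /= comp_lfunE lfunE.
Qed.

Theorem proposition2p14 (R : realType) (V W : vectType R)
    (DV : diffeology R V) (DW : diffeology R W)
    (dvsV : diffeological_vector_space DV)
    (dvsW : diffeological_vector_space DW)
    (V1 : {vspace V}) (W1 : {vspace W})
    (V1_max : maximal_isotropic DV V1) (W1_max : maximal_isotropic DW W1)
    (f : {linear V -> W}) (f_smooth : smooth DV DW f) :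
  (exists! f_q : vquot V1 -> vquot W1,
     forall v, f_q (\pi_(vquot V1) v) = \pi_(vquot W1) (f v)) /\
  (forall f_q : vquot V1 -> vquot W1,
     (forall v, f_q (\pi_(vquot V1) v) = \pi_(vquot W1) (f v)) ->
     linear f_q /\
     smooth (quot_diffeology DV V1) (quot_diffeology DW W1) f_q).
Proof.
split.
  exists (fun x => \pi_(vquot W1) (f (repr x))); split=> [v | h hE].
    (* The chosen representative of the class of [v] differs from [v] by an element of [V1], which
       [f] sends into [W1]. *)
    apply/eqP; rewrite vquot_eqP -linearB.
    apply: (smooth_linear_maximal_isotropic V1_max W1_max f_smooth).
    by rewrite -vquot_eqP reprK.
  (* Uniqueness: every class is the projection of its representative. *)
  by apply/funext => x; rewrite -hE reprK.
move=> h hE; split.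
  move=> a; elim/quotW => u; elim/quotW => v.
  have piZ (T : vectType R) (U : {vspace T}) b (w : T) :
    b *: \pi_(vquot U) w = \pi_(vquot U) (b *: w) by exact: pi_vquot_scale.
  by rewrite piZ -raddfD !hE linearP raddfD piZ.
move=> n U p [oU lift]; split=> // x Ux.
have [A [q [Ax AU qA pq]]] := lift x Ux.
(* Composing a local lift [q] of [p] with [f] gives a local lift of [h \o p]. *)
exists A, (f \o q); split=> //; first exact: f_smooth.
by move=> y Ay /=; rewrite pq.
Qed.
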